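(* Let $I\ge 2$, $\mathcal I=\{1,\dots,I\}$, $N\ge 1$, and let $\bar a_k,\bar b_{ik}\in\mathbb R$ and $\bar q_{ik},\bar q_{iN},\bar r_{ik}>0$ for $i\in\mathcal I$, $k\in\{0,\dots,N-1\}$. Consider the deterministic scalar system $$\bar x_{k+1}=\bar a_k\bar x_k+\sum_{i\in\mathcal I}\bar b_{ik}\bar u_{ik},\qquad k\in\{0,\dots,N-1\},\quad \bar x_0\in\mathbb R \text{ given},$$ in which each agent $i\in\mathcal I$ chooses $(\bar u_{ik})_{k=0}^{N-1}$ in order to minimize $$L_i(\bar x_0,\bar u)=\bar q_{iN}\bar x_N^4+\sum_{k=0}^{N-1}\left(\bar q_{ik}\bar x_k^4+\bar r_{ik}\bar u_{ik}^4\right).$$ Define $\bar\alpha_{ik}$ by backward recursion: $\bar\alpha_{iN}=\bar q_{iN}$ and, for $k=N-1,\dots,0$, $$\bar\alpha_{ik}=\bar q_{ik}+\bar r_{ik}\left((\bar E_k^{-1}\bar c_k)_i\,\bar a_k\right)^4+\bar\alpha_{i,k+1}\left(\bar a_k-\sum_{j\in\mathcal I}(\bar E_k^{-1}\bar c_k)_j\,\bar a_k\bar b_{jk}\right)^4,$$ where $\bar c_k=(\bar c_{1k},\dots,\bar c_{Ik})^\top$ with $$\bar c_{ik}=\frac{\left(\frac{\bar\alpha_{i,k+1}\bar b_{ik}}{\bar r_{ik}}\right)^{1/3}}{1+\left(\frac{\bar\alpha_{i,k+1}\bar b_{ik}}{\bar r_{ik}}\right)^{1/3}\bar b_{ik}},$$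 and $\bar E_k$ is the $I\times I$ matrix with entries $\bar e_{ii,k}=1$ and $\bar e_{ij,k}=\bar c_{ik}\bar b_{jk}$ for $j\ne i$. Then the (state-feedback Nash) equilibrium strategy of the game is $$\bar u_{ik}^*=-(\bar E_k^{-1}\bar c_k)_i\,(\bar a_k\bar x_k),\qquad i\in\mathcal I,\ k\in\{0,\dots,N-1\}.$$
   Context: Cube roots are real (odd) roots. The control set of each agent at each step is $\mathbb R$; a strategy of agent $i$ is a sequence $(\bar u_{ik})_{k=0}^{N-1}$ of Lebesgue measurable state-feedback maps, $\bar u_{ik}=\bar u_{ik}(\bar x_k)\in\mathbb R$. A profile $(\bar u_i^* )_{i\in\mathcal I}$ of such strategies is a state-feedback Nash equilibrium if, for every $i\in\mathcal I$, when all agents $j\neq i$ use the feedback strategies $\bar u_j^*$, the strategy $\bar u_i^*$ minimizes $L_i$ over all strategies of agent $i$. *)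

(* Defs.v *)
From HB Require Import structures.
From mathcomp Require Import all_boot all_order all_algebra.
From mathcomp Require Import all_classical all_reals all_analysis.

Set Implicit Arguments.
Unset Strict Implicit.
Unset Printing Implicit Defensive.

Import Order.TTheory GRing.Theory Num.Theory.
Import numFieldNormedType.Exports.

Local Open Scope classical_set_scope.
Local Open Scope ring_scope.

Section OddRoot.
Context {R : realType}.

Definition cbrt (x : R) : R := Num.sg x * (`|x| `^ 3^-1).

Lemma cbrt_pow3 (x : R) : cbrt x ^+ 3 = x.
Proof.
have e : (`|x| `^ 3^-1) ^+ 3 = `|x|.
  by rewrite -powR_mulrn ?powR_ge0// -powRrM mulVf ?pnatr_eq0// powRr1.
rewrite /cbrt exprMn e [x in RHS]numEsg exprS; case: (eqVneq x 0) => [->|x0].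
  by rewrite sgr0 !mul0r.
by rewrite sqr_sg x0 mulr1.
Qed.

End OddRoot.

(* Lebesgue (not merely Borel) measurability: the source carries the
   Caratheodory sigma-algebra on which [completed_lebesgue_measure] is defined,
   the target carries the Borel sigma-algebra. *)
Definition lebesgue_measurable_fun (R : realType) (f : R -> R) : Prop :=
  @measurable_fun _ _
    (caratheodory_type ((wlength (@idfun R))^*)%mu) (measurableTypeR R) setT f.

Section Game.
Context {R : realType} {n : nat}.
(* Agents are indexed by 'I_n and stages by nat; [q i N] is the terminal weight,
   and only the stages k < N of [a], [b], [r] and of the strategies matter. *)
Variables (N : nat) (a : nat -> R) (b q r : 'I_n -> nat -> R).

Definition strategy := nat -> R -> R.
Definition profile := 'I_n -> strategy.

Definition admissible (v : strategy) : Prop :=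
  forall k, (k < N)%N -> lebesgue_measurable_fun (v k).

Fixpoint state (x0 : R) (u : profile) (k : nat) : R :=
  if k is k'.+1 then
    let x := state x0 u k' in a k' * x + \sum_(i < n) b i k' * u i k' x
  else x0.

Definition cost (i : 'I_n) (x0 : R) (u : profile) : R :=
  q i N * state x0 u N ^+ 4 +
  \sum_(k < N) (q i k * state x0 u k ^+ 4
                + r i k * u i k (state x0 u k) ^+ 4).

Definition deviate (u : profile) (i : 'I_n) (v : strategy) : profile :=
  fun j => if j == i then v else u j.

Definition feedback_nash (x0 : R) (u : profile) : Prop :=
  (forall i, admissible (u i)) /\
  (forall (i : 'I_n) (v : strategy), admissible v ->
     cost i x0 u <= cost i x0 (deviate u i v)).

(* In the stage-k formulas below, [al j] stands for alpha_{j,k+1}. *)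
Definition stage_root (al : 'I_n -> R) (k : nat) (i : 'I_n) : R :=
  cbrt (al i * b i k / r i k).

Definition stage_c (al : 'I_n -> R) (k : nat) : 'cV[R]_n :=
  \col_i (stage_root al k i / (1 + stage_root al k i * b i k)).

Definition stage_E (al : 'I_n -> R) (k : nat) : 'M[R]_n :=
  \matrix_(i, j) (if i == j then 1 else stage_c al k i 0 * b j k).

Definition stage_gain (al : 'I_n -> R) (k : nat) : 'cV[R]_n :=
  invmx (stage_E al k) *m stage_c al k.

Definition stage_alpha (al : 'I_n -> R) (k : nat) (i : 'I_n) : R :=
  q i k + r i k * (stage_gain al k i 0 * a k) ^+ 4
  + al i * (a k - \sum_(j < n) stage_gain al k j 0 * a k * b j k) ^+ 4.

(* [alpha_back m i] is alpha_{i,N-m}. *)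
Fixpoint alpha_back (m : nat) : 'I_n -> R :=
  if m is m'.+1 then stage_alpha (alpha_back m') (N - m'.+1)%N
  else fun i => q i N.

Definition alpha (k : nat) (i : 'I_n) : R := alpha_back (N - k) i.

Lemma alphaN i : alpha N i = q i N.
Proof. by rewrite /alpha subnn. Qed.

Lemma alpha_rec k i : (k < N)%N -> alpha k i = stage_alpha (alpha k.+1) k i.
Proof. by move=> kN; rewrite /alpha -(subnSK kN) /= (subnSK kN) subKn// ltnW. Qed.

Definition root_term (k : nat) (i : 'I_n) : R := stage_root (alpha k.+1) k i.
Definition Emx (k : nat) : 'M[R]_n := stage_E (alpha k.+1) k.
Definition gain (k : nat) : 'cV[R]_n := stage_gain (alpha k.+1) k.

Definition eq_strategy : profile := fun i k x => - gain k i 0 * (a k * x).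

End Game.

(* Main.v *)
Require Import Defs.
From HB Require Import structures.
From mathcomp Require Import all_boot all_order all_algebra.
From mathcomp Require Import all_classical all_reals all_analysis.
From mathcomp Require Import measurable_realfun ring.

Set Implicit Arguments.
Unset Strict Implicit.
Unset Printing Implicit Defensive.

Import Order.TTheory GRing.Theory Num.Theory.
Local Open Scope ring_scope.

(** The control enters each stage through the roots
    [t_i = (al_i b_i / r_i)^(1/3)], where [al_i] is agent [i]'s weight for the
    next stage; it is positive because [alpha_i >= q_i] at every stage
    ([alpha_gt0]).  Since [t_i b_i = t_i^4 r_i / al_i], this product is
    nonnegative; hence [1 + t_i b_i >= 1] and the closed-loop loading
    [T = \sum_j t_j b_j] is nonnegative.  Since [E] is
    [diag (1 + t_i b_i)^-1] times the rank-one perturbation [1 + t b^T], whose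
    determinant is [1 + T], it is invertible and the gain is
    [E^-1 c = t / (1 + T)] ([stage_E_unit], [stage_gainE]).

    Under these feedbacks the state moves from [x] to [z = a x / (1 + T)], and
    agent [i] plays [- t_i z].  Against the other agents, replacing that
    control by [v] moves the next state to [z + b_i (v + t_i z)], so agent [i]
    faces the convex function
    [r_i v^4 + al_i (z + b_i (v + t_i z))^4], whose derivative at [- t_i z] is
    [4 z^3 (al_i b_i - r_i t_i^3) = 0].  So [- t_i z] is a global minimizer
    ([quartic_stage_min]), and the minimum plus [q_i x^4] is exactly
    [alpha_i x^4] by the backward recursion.

    Thus [alpha_{i,k} x^4] is the value function of agent [i]: along any
    trajectory in which only agent [i] deviates it decreases by at most the
    stage cost, with equality along the equilibrium
    ([alpha_step_le], [alpha_step_eq]).  Telescoping over the stages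
    bounds every deviating cost from below by [alpha_{i,0} x_0^4], which is the
    equilibrium cost. *)

(** * Tangent lines and the one-stage problem *)

(** The tangent line of the convex function [x^4] at [y]; the gap is
    [(x - y)^2 ((x + y)^2 + 2 y^2)]. *)
Lemma quartic_tangent (R : realDomainType) (x y : R) :
  y ^+ 4 + 4%:R * y ^+ 3 * (x - y) <= x ^+ 4.
Proof.
rewrite -subr_ge0.
have -> : x ^+ 4 - (y ^+ 4 + 4%:R * y ^+ 3 * (x - y)) =
          (x - y) ^+ 2 * ((x + y) ^+ 2 + 2%:R * y ^+ 2) by ring.
by rewrite mulr_ge0 ?sqr_ge0// addr_ge0 ?sqr_ge0// mulr_ge0 ?sqr_ge0// ler0n.
Qed.

(** The hypothesis [r * t ^+ 3 = al * b] is the first-order condition at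
    [v = - (t * z)]: it cancels the linear parts of the two tangent lines. *)
Lemma quartic_stage_min (R : realDomainType) (r al b t z v : R) :
  0 <= r -> 0 <= al -> r * t ^+ 3 = al * b ->
  r * (- (t * z)) ^+ 4 + al * z ^+ 4 <=
  r * v ^+ 4 + al * (z + b * (v + t * z)) ^+ 4.
Proof.
move=> r0 al0 foc.
have hv := ler_wpM2l r0 (quartic_tangent v (- (t * z))).
have hz := ler_wpM2l al0 (quartic_tangent (z + b * (v + t * z)) z).
apply: le_trans (lerD hv hz); rewrite le_eqVlt; apply/orP; left; apply/eqP.
ring: foc.
Qed.

(** * The linear system for the feedback gains *)

Section Stage.
Context {R : realType} {n : nat}.
Variables (a : nat -> R) (b q r : 'I_n -> nat -> R) (al : 'I_n -> R) (k : nat).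
Hypothesis al_gt0 : forall i, 0 < al i.
Hypothesis r_gt0 : forall i, 0 < r i k.

Local Notation t := (stage_root b r al k).
Local Notation c := (stage_c b r al k).

Lemma stage_root_foc i : r i k * t i ^+ 3 = al i * b i k.
Proof. by rewrite cbrt_pow3 mulrC divfK// gt_eqF. Qed.

(** The first-order condition turns [al_i t_i b_i] into [r_i t_i^4], an even
    power. *)
Lemma stage_root_mul_ge0 i : 0 <= t i * b i k.
Proof.
rewrite -(pmulr_rge0 _ (al_gt0 i)).
have -> : al i * (t i * b i k) = r i k * t i ^+ 4.
  by rewrite mulrCA -stage_root_foc mulrCA -exprS.
by rewrite mulr_ge0 ?(ltW (r_gt0 i))// exprn_even_ge0.
Qed.

Lemma stage_den_neq0 i : 1 + t i * b i k != 0.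
Proof. by rewrite gt_eqF// ltr_pwDl// stage_root_mul_ge0. Qed.

Definition stage_load : R := \sum_j t j * b j k.

Lemma stage_load_neq0 : 1 + stage_load != 0.
Proof.
by rewrite gt_eqF// ltr_pwDl// sumr_ge0// => i _; apply: stage_root_mul_ge0.
Qed.

Lemma stage_cE i : c i 0 = t i / (1 + t i * b i k).
Proof. by rewrite mxE. Qed.

(** A diagonal matrix plus the rank-one matrix [c b^T]; the diagonal part is
    [1 - c_i b_i = (1 + t_i b_i)^-1]. *)
Lemma stage_EE i j :
  stage_E b r al k i j =
  (i == j)%:R / (1 + t i * b i k) + c i 0 * b j k.
Proof.
have d0 := stage_den_neq0 i.
rewrite !mxE; case: eqVneq => [<-|_]; last by rewrite mul0r add0r.
by rewrite mul1r; field.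
Qed.

(** A left null vector [v] satisfies [v_j = - s b_j (1 + t_j b_j)] with
    [s = v c]; multiplying by [c_j] and summing gives [s = - s T], so [s = 0]
    and then [v = 0]. *)
Lemma stage_E_unit : stage_E b r al k \in unitmx.
Proof.
rewrite unitmxE unitfE; apply/det0P => -[v v0 vE0].
pose s := \sum_i v 0 i * c i 0.
have vj j : v 0 j = - (s * b j k) * (1 + t j * b j k).
  have /matrixP/(_ 0 j) := vE0; rewrite !mxE.
  under eq_bigr do rewrite stage_EE mulrDr mulrA [X in _ + X]mulrA.
  rewrite big_split/= -mulr_suml -/s (bigD1 j)//= eqxx mulr1 big1 ?addr0; last first.
    by move=> i /negbTE->; rewrite mulr0 mul0r.
  by move=> /(canRL (addrK _)); rewrite sub0r => /(canRL (divfK (stage_den_neq0 j))).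
have s0 : s = 0.
  have : s = - s * stage_load.
    rewrite {1}/s mulr_sumr; apply: eq_bigr => j _.
    have d0 := stage_den_neq0 j.
    by rewrite vj stage_cE; field.
  move=> sT; have : s * (1 + stage_load) = 0 by rewrite mulrDr mulr1 {1}sT; ring.
  by move/eqP; rewrite mulf_eq0 (negbTE stage_load_neq0) orbF => /eqP.
move/eqP: v0; apply; apply/rowP => j.
by rewrite vj s0 mul0r oppr0 mul0r mxE.
Qed.

(** With [g = t / (1 + T)] one has [b^T g = T / (1 + T)], so row [i] of
    [E g = c] reads [c_i / (1 + T) + c_i T / (1 + T) = c_i]. *)
Lemma stage_gainE i : stage_gain b r al k i 0 = t i / (1 + stage_load).
Proof.
have T0 := stage_load_neq0.
pose g : 'cV[R]_n := \col_i (t i / (1 + stage_load)).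
suff Eg : stage_E b r al k *m g = c.
  by rewrite /stage_gain -Eg mulKmx ?stage_E_unit// mxE.
apply/colP => l; rewrite mxE.
under eq_bigr do rewrite stage_EE mulrDl.
rewrite big_split/= (bigD1 l)//= eqxx big1 ?addr0; last first.
  by move=> j /negbTE jl; rewrite eq_sym jl !mul0r.
have -> : \sum_j c l 0 * b j k * g j 0 = c l 0 * (stage_load / (1 + stage_load)).
  by rewrite mulr_suml mulr_sumr; apply: eq_bigr => j _; rewrite !mxE; ring.
have d0 := stage_den_neq0 l.
by rewrite stage_cE mxE mul1r; field; rewrite d0 T0.
Qed.

Lemma stage_closed_loop :
  a k - \sum_j stage_gain b r al k j 0 * a k * b j k = a k / (1 + stage_load).
Proof.
have T0 := stage_load_neq0.
have -> : \sum_j stage_gain b r al k j 0 * a k * b j k =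
    stage_load * (a k / (1 + stage_load)).
  by rewrite mulr_suml; apply: eq_bigr => j _; rewrite stage_gainE; ring.
by field.
Qed.

Lemma stage_alpha_gt0 i : 0 < q i k -> 0 < stage_alpha a b q r al k i.
Proof.
move=> q0; rewrite /stage_alpha -addrA ltr_pwDl// addr_ge0//.
  by rewrite mulr_ge0 ?exprn_even_ge0// ltW.
by rewrite mulr_ge0 ?exprn_even_ge0// ltW.
Qed.

(** [z] is the closed-loop successor of [x]; the equilibrium controls are
    [- t_i z]. *)
Lemma stage_alphaE i x : let z := a k * x / (1 + stage_load) in
  stage_alpha a b q r al k i * x ^+ 4 =
  q i k * x ^+ 4 + (r i k * (- (t i * z)) ^+ 4 + al i * z ^+ 4).
Proof.
by rewrite /= /stage_alpha stage_closed_loop stage_gainE; ring.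
Qed.

End Stage.

(** * Value functions and the equilibrium *)

Section Equilibrium.
Context {R : realType} {n : nat}.
Variables (N : nat) (a : nat -> R) (b q r : 'I_n -> nat -> R).
Hypothesis hq : forall i k, (k <= N)%N -> 0 < q i k.
Hypothesis hr : forall i k, (k < N)%N -> 0 < r i k.

Local Notation al := (alpha N a b q r).
Local Notation ustar := (eq_strategy N a b q r).

Lemma alpha_gt0 k i : (k <= N)%N -> 0 < al k i.
Proof.
move=> kN; rewrite -(subKn kN); elim: (N - k)%N (leq_subr k N) i => [|m IHm] mN i.
  by rewrite subn0 alphaN hq.
have lt : (N - m.+1 < N)%N by rewrite ltn_subrL (leq_trans _ mN).
rewrite alpha_rec// subnSK//; apply: stage_alpha_gt0.
- by move=> j; apply: IHm; exact: ltnW.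
- by move=> j; exact: hr.
- by rewrite hq// ltnW.
Qed.

Section AtStage.
Variables (k : nat) (kN : (k < N)%N).

Let alk i : 0 < al k.+1 i. Proof. exact: alpha_gt0. Qed.
Let rk i : 0 < r i k. Proof. exact: hr. Qed.
Let T := stage_load b r (al k.+1) k.
Let z x := a k * x / (1 + T).

Lemma eq_strategyE i x : ustar i k x = - (root_term N a b q r k i * z x).
Proof.
rewrite /eq_strategy /gain stage_gainE// /root_term /z -/T; ring.
Qed.

Lemma next_state_eq x : a k * x + \sum_i b i k * ustar i k x = z x.
Proof.
have T0 : 1 + T != 0 by exact: stage_load_neq0.
have -> : \sum_i b i k * ustar i k x = - T * z x.
  rewrite mulNr mulr_suml -sumrN; apply: eq_bigr => i _.
  by rewrite eq_strategyE /root_term; ring.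
by rewrite /z; field.
Qed.

(** Only agent [i]'s own term changes, so the next state is the closed-loop one
    shifted by [b_i] times the change of control, the form in which
    [quartic_stage_min] applies. *)
Lemma next_state_deviate i (v : strategy) x :
  a k * x + \sum_j b j k * deviate ustar i v j k x =
  z x + b i k * (v k x + root_term N a b q r k i * z x).
Proof.
have := next_state_eq x; rewrite (bigD1 i)//= eq_strategyE => zE.
rewrite (bigD1 i)//= /deviate eqxx.
rewrite (eq_bigr (fun j => b j k * ustar j k x)); last by move=> j /negbTE ->.
(* Only the undeviated successor is expanded; the [z x] inside agent [i]'s
   correction cancels against the one in its equilibrium control. *)
by rewrite -{1}zE; ring.
Qed.

End AtStage.

(** The Bellman inequality for agent [i] against the equilibrium strategies of
    the others. *)
Lemma alpha_step_le i (v : strategy) x0 k (u := deviate ustar i v)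
    (x := state a b x0 u) : (k < N)%N ->
  al k i * x k ^+ 4 <=
  q i k * x k ^+ 4 + r i k * u i k (x k) ^+ 4 + al k.+1 i * x k.+1 ^+ 4.
Proof.
move=> kN; have alk j : 0 < al k.+1 j by exact: alpha_gt0.
have rk j : 0 < r j k by exact: hr.
have -> : x k.+1 = a k * x k + \sum_j b j k * u j k (x k) by [].
rewrite next_state_deviate// /u /deviate eqxx alpha_rec//.
rewrite stage_alphaE// -[leRHS]addrA lerD2l.
by apply: quartic_stage_min; rewrite ?ltW// stage_root_foc.
Qed.

Lemma alpha_step_eq i x0 k (x := state a b x0 ustar) : (k < N)%N ->
  al k i * x k ^+ 4 =
  q i k * x k ^+ 4 + r i k * ustar i k (x k) ^+ 4 + al k.+1 i * x k.+1 ^+ 4.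
Proof.
move=> kN; have alk j : 0 < al k.+1 j by exact: alpha_gt0.
have rk j : 0 < r j k by exact: hr.
have -> : x k.+1 = a k * x k + \sum_j b j k * ustar j k (x k) by [].
by rewrite next_state_eq// eq_strategyE// alpha_rec// stage_alphaE// -[RHS]addrA.
Qed.

Lemma cost_deviate_ge i (v : strategy) x0 :
  al 0 i * x0 ^+ 4 <= cost N a b q r i x0 (deviate ustar i v).
Proof.
rewrite /cost; set u := deviate _ _ _; set x := state a b x0 u.
rewrite -(alphaN N a b q r i).
suff H m : (m <= N)%N -> al 0 i * x0 ^+ 4 <= al m i * x m ^+ 4 +
    \sum_(k < m) (q i k * x k ^+ 4 + r i k * u i k (x k) ^+ 4) by exact: H.
elim: m => [_|m IHm mN]; first by rewrite big_ord0 addr0.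
apply: le_trans (IHm (ltnW mN)) _.
rewrite big_ord_recr/= [leRHS]addrCA [leLHS]addrC lerD2l [leRHS]addrC.
exact: alpha_step_le.
Qed.

Lemma cost_eq_strategy i x0 : cost N a b q r i x0 ustar = al 0 i * x0 ^+ 4.
Proof.
rewrite /cost; set x := state a b x0 ustar.
rewrite -(alphaN N a b q r i).
suff H m : (m <= N)%N -> al m i * x m ^+ 4 +
    \sum_(k < m) (q i k * x k ^+ 4 + r i k * ustar i k (x k) ^+ 4) =
    al 0 i * x0 ^+ 4 by exact: H.
elim: m => [_|m IHm mN]; first by rewrite big_ord0 addr0.
rewrite -(IHm (ltnW mN)) (alpha_step_eq i x0 mN) big_ord_recr/= -/x.
by rewrite [LHS]addrCA [RHS]addrC; congr (_ + _); rewrite addrC.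
Qed.

End Equilibrium.

(** Borel sets are Caratheodory measurable, so Borel measurability of a
    continuous map is enough. *)
Lemma lebesgue_measurable_linear (R : realType) (c : R) :
  lebesgue_measurable_fun (fun x => c * x).
Proof.
move=> _ Y mY; rewrite setTI.
have mf : measurable_fun [set: measurableTypeR R] (fun x : R => c * x).
  exact: mulrl_measurable.
apply: sub_caratheodory.
by have := mf measurableT Y mY; rewrite setTI.
Qed.

Theorem proposition1 (R : realType) (n N : nat) (a : nat -> R)
    (b q r : 'I_n -> nat -> R) (x0 : R)
    (hn : (2 <= n)%N) (hN : (1 <= N)%N)
    (hq : forall (i : 'I_n) (k : nat), (k <= N)%N -> 0 < q i k)
    (hr : forall (i : 'I_n) (k : nat), (k < N)%N -> 0 < r i k) :
  (* the formulas for c_k and E_k^{-1} are meaningful *)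
  (forall k : nat, (k < N)%N ->
     (forall i : 'I_n, 1 + root_term N a b q r k i * b i k != 0) /\
     Emx N a b q r k \in unitmx) /\
  feedback_nash N a b q r x0 (eq_strategy N a b q r).
Proof.
split=> [k kN|].
  have alk j : 0 < alpha N a b q r k.+1 j by exact: alpha_gt0.
  have rk j : 0 < r j k by exact: hr.
  by split=> [i|]; [exact: stage_den_neq0 | exact: stage_E_unit].
split=> [i k _|i v _].
  have -> : eq_strategy N a b q r i k =
      (fun x => (- gain N a b q r k i 0 * a k) * x).
    by apply/funext => x; rewrite /eq_strategy mulrA.
  exact: lebesgue_measurable_linear.
by rewrite cost_eq_strategy//; exact: cost_deviate_ge.
Qed.
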